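(* In the setting described, for every $1\le d\le d_0$ the map $\widehat{\mathcal H_{<d}}:\mathcal R\to\mathbb K$ is an $\mathbb F_p$-algebra homomorphism from $(\mathcal R,\ast)$; that is, $\widehat{\mathcal H_{<d}}(x_{\mathbf r}\ast x_{\mathbf s})=\mathcal H_{<d}(\mathbf r)\mathcal H_{<d}(\mathbf s)$ for all indices $\mathbf r,\mathbf s\in\mathbf I$.
   Context: Let $r$ be a power of a prime $p$, $A=\mathbb F_r[\theta]$, $A_{<d}$ the polynomials of degree $<d$ (including $0$). Let $\mathbb K$ be an integral domain containing $\mathbb F_r$, $d_0\in\mathbb N$, and suppose each $a\in A_{<d_0}$ is assigned $[a]\in\mathbb K$ with: $[a]\in\mathbb K^\times$ for monic $a$ of degree $<d_0$; $[a+b]=[a]+[b]$; $[\varepsilon a]=\varepsilon[a]$ for $\varepsilon\in\mathbb F_r$. $\mathbf I$ is the set of finite tuples of positive integers including $\varnothing$. For non-empty $\mathbf s=(s_1,\dots,s_m)\in\mathbf I$ and $1\le d\le d_0$, $\mathcal H_{<d}(\mathbf s)=\sum[a_1]^{-s_1}\cdots[a_m]^{-s_m}$ over monic $a_1,\dots,a_m$ with $d>\deg a_1>\cdots>\deg a_m\ge0$; $\mathcal H_{<d}(\varnothing)=1$. The $r$-shuffle algebra: $\mathcal R$ is the $\mathbb F_p$-vector space with basis the free monoid on $x_k$ ($k\in\mathbb N$); $x_{\mathbf s}=x_{s_1}\cdots x_{s_m}$, $x_\varnothing=1$, $\mathbf s^-=(s_2,\dots,s_m)$; for $r_1,s_1\in\mathbb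 N$ and positive $i,j$, $\Delta^{i,j}_{r_1,s_1}=(-1)^{r_1-1}\binom{j-1}{r_1-1}+(-1)^{s_1-1}\binom{j-1}{s_1-1}$ if $(r-1)\mid j$, else $0$ (binomials mod $p$). The product $\ast$ is $\mathbb F_p$-bilinear, defined by induction on total depth: $1\ast x_{\mathbf s}=x_{\mathbf s}\ast1=x_{\mathbf s}$ and for non-empty $\mathbf r,\mathbf s$: $x_{\mathbf r}\ast x_{\mathbf s}=x_{r_1}(x_{\mathbf r^-}\ast x_{\mathbf s})+x_{s_1}(x_{\mathbf r}\ast x_{\mathbf s^-})+x_{r_1+s_1}(x_{\mathbf r^-}\ast x_{\mathbf s^-})+\sum_{i+j=r_1+s_1}\Delta^{i,j}_{r_1,s_1}x_i((x_{\mathbf r^-}\ast x_{\mathbf s^-})\ast x_j)$, juxtaposition meaning concatenation extended linearly. $\widehat{\mathcal H_{<d}}:\mathcal R\to\mathbb K$ is the $\mathbb F_p$-linear map $1\mapsto1$, $x_{\mathbf s}\mapsto\mathcal H_{<d}(\mathbf s)$. *)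

(* Defs.v *)
From HB Require Import structures.
From mathcomp Require Import all_boot all_order all_algebra all_field.
From mathcomp Require Import finmap monalg.
Set Implicit Arguments.
Unset Strict Implicit.
Unset Printing Implicit Defensive.
Import GRing.Theory.
Local Open Scope ring_scope.

(* Here, as in the source, the natural numbers start at 1. *)
Definition posnat := {n : nat | (0 < n)%N}.

Definition posS (n : nat) : posnat := exist _ n.+1 (ltn0Sn n).

Definition posD (m n : posnat) : posnat :=
  exist _ (val m + val n)%N (ltn_addr (val n) (valP m)).

Notation pindex := (seq posnat).

Section RShuffle.
Variables (p r : nat).

(* The ring product of this monoid algebra is the bilinear extension of
   concatenation of words, i.e. juxtaposition, NOT the r-shuffle product. *)
Definition rshuffle := {malg 'F_p[{fmonom posnat}]}.

Definition xword (s : pindex) : rshuffle := << FMonom s >>.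

Definition xlet (k : posnat) : rshuffle := xword [:: k].

Definition Delta (a b i j : nat) : 'F_p :=
  if (r.-1 %| j)%N then
    (-1) ^+ a.-1 * 'C(j.-1, a.-1)%:R + (-1) ^+ b.-1 * 'C(j.-1, b.-1)%:R
  else 0.

(* The r-shuffle product of two words. The recursive definition is not
   structural, so it is driven by a bound n on the total depth; the value for
   insufficient n is irrelevant, see [shuf_fuel] and [star_cons]. *)
Fixpoint shuf (n : nat) (s t : pindex) {struct n} : rshuffle :=
  match s, t, n with
  | [::], _, _ => xword t
  | _, [::], _ => xword s
  | _, _, 0%N => 0
  | a :: s', b :: t', n'.+1 =>
      xlet a * shuf n' s' t + xlet b * shuf n' s t'
      + xlet (posD a b) * shuf n' s' t'
      + \sum_(i < val a + val b) \sum_(j < val a + val b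
                                      | (i.+1 + j.+1 == val a + val b)%N)
          Delta (val a) (val b) i.+1 j.+1 *:
            (xlet (posS i) *
             \sum_(w <- msupp (shuf n' s' t'))
               (shuf n' s' t')@_w *: shuf n' w [:: posS j])
  end.

Definition star (u v : rshuffle) : rshuffle :=
  \sum_(s <- msupp u) \sum_(t <- msupp v)
    (u@_s * v@_t) *: shuf (size s + size t) s t.

(* Sanity checks: [star] is bilinear and satisfies the defining recursion. *)

Lemma starEw (d1 d2 : {fset {fmonom posnat}}) (u v : rshuffle) :
  (msupp u `<=` d1)%fset -> (msupp v `<=` d2)%fset ->
  star u v = \sum_(s <- d1) \sum_(t <- d2)
    (u@_s * v@_t) *: shuf (size s + size t) s t.
Proof.
move=> le1 le2; rewrite /star (big_fset_incl _ le1) /=; last first.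
  move=> s _ /mcoeff_outdom us0.
  by rewrite big1 // => t _; rewrite us0 mul0r scale0r.
apply: eq_bigr => s _; rewrite (big_fset_incl _ le2) //=.
by move=> t _ /mcoeff_outdom ->; rewrite mulr0 scale0r.
Qed.

Lemma star_linearl (c : 'F_p) (u u' v : rshuffle) :
  star (c *: u + u') v = c *: star u v + star u' v.
Proof.
set d := (msupp u `|` msupp u')%fset.
have le1 : (msupp (c *: u + u') `<=` d)%fset.
  apply: (fsubset_trans (msuppD_le _ _)).
  exact: (fsetSU _ (msuppZ_le c u)).
rewrite (starEw le1 (fsubset_refl _)).
rewrite (starEw (fsubsetUl _ (msupp u')) (fsubset_refl (msupp v))).
rewrite (starEw (fsubsetUr (msupp u) _) (fsubset_refl (msupp v))).
rewrite scaler_sumr -big_split; apply: eq_bigr => s _ /=.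
rewrite scaler_sumr -big_split; apply: eq_bigr => t _ /=.
by rewrite mcoeffD mcoeffZ mulrDl scalerDl scalerA mulrA.
Qed.

Lemma star_linearr (c : 'F_p) (u v v' : rshuffle) :
  star u (c *: v + v') = c *: star u v + star u v'.
Proof.
set d := (msupp v `|` msupp v')%fset.
have le1 : (msupp (c *: v + v') `<=` d)%fset.
  apply: (fsubset_trans (msuppD_le _ _)).
  exact: (fsetSU _ (msuppZ_le c v)).
rewrite (starEw (fsubset_refl _) le1).
rewrite (starEw (fsubset_refl (msupp u)) (fsubsetUl _ (msupp v'))).
rewrite (starEw (fsubset_refl (msupp u)) (fsubsetUr (msupp v) _)).
rewrite scaler_sumr -big_split; apply: eq_bigr => s _ /=.
rewrite scaler_sumr -big_split; apply: eq_bigr => t _ /=.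
by rewrite mcoeffD mcoeffZ mulrDr scalerDl scalerA mulrCA.
Qed.

Lemma star_xword (s t : pindex) :
  star (xword s) (xword t) = shuf (size s + size t) s t.
Proof.
rewrite (starEw msuppU_le msuppU_le) !big_seq_fset1 !mcoeffUU.
by rewrite mulr1 scale1r.
Qed.

Definition depth_le (n : nat) (u : rshuffle) :=
  forall w : {fmonom posnat}, (n < size w)%N -> u@_w = 0.

Let depth_le0 n : depth_le n 0.
Proof. by move=> w _; rewrite mcoeff0. Qed.

Let depth_leD n u v : depth_le n u -> depth_le n v -> depth_le n (u + v).
Proof. by move=> hu hv w hw; rewrite mcoeffD hu ?hv ?addr0. Qed.

Let depth_leZ n c u : depth_le n u -> depth_le n (c *: u).
Proof. by move=> hu w hw; rewrite mcoeffZ hu ?mulr0. Qed.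

Let depth_le_sum n I (l : seq I) (P : pred I) (G : I -> rshuffle) :
  (forall i, P i -> depth_le n (G i)) -> depth_le n (\sum_(i <- l | P i) G i).
Proof. by move=> h; apply: big_ind => //; apply: depth_leD. Qed.

Let depth_le_xword n s : (size s <= n)%N -> depth_le n (xword s).
Proof.
move=> hs w hw; rewrite mcoeffU; case: eqP => // e.
by move: hw; rewrite -e /= ltnNge hs.
Qed.

Let depth_le_xlet n k u : depth_le n u -> depth_le n.+1 (xlet k * u).
Proof.
move=> hu; rewrite malgM_def fgmulUg; apply: depth_le_sum => w' _ w hw.
rewrite mcoeffU mul1r; case: eqP => // e; rewrite hu //.
by move: hw; rewrite -e fmM /= ltnS.
Qed.

Lemma depth_le_shuf n s t : depth_le (size s + size t) (shuf n s t).
Proof.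
elim: n s t => [|n IH] [|a s] [|b t] /=; try by apply: depth_le_xword;
  rewrite /= ?addn0 ?add0n.
  exact: depth_le0.
have up m u : (m <= size s + size t)%N -> depth_le m u ->
    depth_le (size s + size t) u.
  by move=> hm hu w hw; apply: hu; apply: leq_ltn_trans hw.
rewrite addSn addnS; apply: depth_leD; first apply: depth_leD;
    first apply: depth_leD.
- by apply: depth_le_xlet; have := IH s (b :: t); rewrite /= addnS.
- by apply: depth_le_xlet; exact: (IH (a :: s) t).
- apply: depth_le_xlet => w hw; apply: IH; exact: ltn_trans hw.
apply: depth_le_sum => i _; apply: depth_le_sum => j _; apply: depth_leZ.
apply: depth_le_xlet => w hw; rewrite raddf_sum big1_seq //= => w' hw'.
rewrite mcoeffZ (IH w') ?mulr0 //= addn1; apply: leq_ltn_trans hw; rewrite ltnS.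
rewrite leqNgt; apply/negP => /IH h.
by move: hw'; rewrite -mcoeff_neq0 h eqxx.
Qed.

Let size_msupp_shuf n s t (w : {fmonom posnat}) :
  w \in msupp (shuf n s t) -> (size w <= size s + size t)%N.
Proof.
by rewrite -mcoeff_neq0 leqNgt; apply: contra => /depth_le_shuf ->.
Qed.

Let shufS n a b s t :
  shuf n.+1 (a :: s) (b :: t) =
    xlet a * shuf n s (b :: t) + xlet b * shuf n (a :: s) t
    + xlet (posD a b) * shuf n s t
    + \sum_(i < val a + val b) \sum_(j < val a + val b
                                    | (i.+1 + j.+1 == val a + val b)%N)
        Delta (val a) (val b) i.+1 j.+1 *:
          (xlet (posS i) *
           \sum_(w <- msupp (shuf n s t))
             (shuf n s t)@_w *: shuf n w [:: posS j]).
Proof. by []. Qed.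

Let shuf0l n t : shuf n [::] t = xword t.
Proof. by case: n. Qed.

Let shuf0r n s : shuf n s [::] = xword s.
Proof. by case: n; case: s. Qed.

Lemma shuf_fuel n m s t : (size s + size t <= n)%N -> (size s + size t <= m)%N ->
  shuf n s t = shuf m s t.
Proof.
elim: n m s t => [|n IH] m [|a s] [|b t]; rewrite ?shuf0l ?shuf0r; try by [].
case: m => [|m]; first by [].
rewrite [size (a :: s)]/= [size (b :: t)]/= addSn addnS !ltnS => hn hm.
have hn' := ltnW hn; have hm' := ltnW hm.
have e1 : shuf n s (b :: t) = shuf m s (b :: t) by apply: IH; rewrite addnS.
have e2 : shuf n (a :: s) t = shuf m (a :: s) t by apply: IH; rewrite addSn.
rewrite !shufS (IH m s t hn' hm') e1 e2.
apply: (congr1 (+%R _)); apply: eq_bigr => i _; apply: eq_bigr => j _.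
apply: (congr1 (fun z => _ *: (_ * z))); apply: eq_big_seq => w /size_msupp_shuf hw.
apply: (congr1 ( *:%R _)); apply: IH; rewrite [size [:: _]]/= addn1.
  exact: leq_ltn_trans hw hn.
exact: leq_ltn_trans hw hm.
Qed.

Lemma star1x (s : pindex) : star (xword [::]) (xword s) = xword s.
Proof. by rewrite star_xword; case: s. Qed.

Lemma starx1 (s : pindex) : star (xword s) (xword [::]) = xword s.
Proof. by rewrite star_xword; case: s. Qed.

Lemma star_cons (a b : posnat) (s t : pindex) :
  star (xword (a :: s)) (xword (b :: t)) =
    xlet a * star (xword s) (xword (b :: t))
    + xlet b * star (xword (a :: s)) (xword t)
    + xlet (posD a b) * star (xword s) (xword t)
    + \sum_(i < val a + val b) \sum_(j < val a + val b
                                    | (i.+1 + j.+1 == val a + val b)%N)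
        Delta (val a) (val b) i.+1 j.+1 *:
          (xlet (posS i) * star (star (xword s) (xword t)) (xlet (posS j))).
Proof.
have e : shuf (size s + size (b :: t)) s t = star (xword s) (xword t).
  by rewrite star_xword; apply: shuf_fuel; rewrite // addnS.
rewrite (star_xword (a :: s)) [size (a :: s)]/= addSn shufS e.
rewrite (star_xword s (b :: t)) (star_xword (a :: s) t).
rewrite [size (a :: s)]/= addSn -addnS.
apply: (congr1 (+%R _)); apply: eq_bigr => i _.
apply: eq_bigr => j _; apply: (congr1 (fun z => _ *: (_ * z))).
rewrite (starEw (fsubset_refl (msupp (star _ _))) (v := xlet (posS j)) msuppU_le).
apply: eq_big_seq => w; rewrite [in X in X -> _]star_xword => /size_msupp_shuf hw.
rewrite big_seq_fset1 mcoeffUU mulr1; apply: (congr1 ( *:%R _)).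
apply: shuf_fuel; rewrite ?leqnn // [size [:: _]]/= addn1.
by rewrite [size (b :: t)]/= addnS ltnS.
Qed.

End RShuffle.

Section Hsum.
Variables (p : nat) (F : finFieldType) (K : idomainType) (d0 : nat).
Variable br : {poly_d0 F} -> K.

(* For a monic polynomial the degree is (size a).-1; [path gtn d] encodes
   d > deg a_1 > ... > deg a_m. For s empty the only tuple is the empty one
   and the sum is 1. *)
Definition Hlt (d : nat) (s : pindex) : K :=
  \sum_(a : (size s).-tuple {poly_d0 F} |
        all (fun b : {poly_d0 F} => (b : {poly F}) \is monic) a &&
        path gtn d [seq (size (b : {poly F})).-1 | b : {poly_d0 F} <- a])
    \prod_(i < size s) (br (tnth a i)) ^- val (tnth (in_tuple s) i).

Definition Hhat (d : nat) : rshuffle p -> K :=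
  mmap (fun c : 'F_p => (c : nat)%:R) (fun w : {fmonom posnat} => Hlt d w).

End Hsum.

(* Main.v *)
(* Expand the product of H_{<d}(a :: s) and H_{<d}(b :: t) over pairs (x, y) of
   leading monic polynomials.  The pairs with deg x > deg y, deg x < deg y and
   x = y give the three stuffle terms.  For x <> y of equal degree, partial
   fractions split [x]^-a [y]^-b into terms [x]^-i [x - y]^-j and
   [y]^-i [y - x]^-j; with x fixed, x - y runs over all nonzero polynomials of
   degree < deg x, and writing these as a scalar times a monic polynomial turns
   the sum of [x - y]^-j into the sum of e^-j over nonzero scalars e, which is
   -1 or 0, times H_{< deg x}(j).  The products that remain have smaller total
   depth, so induction applies to them. *)

Require Import Defs.
From HB Require Import structures.
From mathcomp Require Import all_boot all_order all_algebra all_field.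
From mathcomp Require Import finmap monalg.
From mathcomp Require Import ring.
Set Implicit Arguments.
Unset Strict Implicit.
Unset Printing Implicit Defensive.
Import GRing.Theory.
Local Open Scope ring_scope.

(** * Partial fractions for a product of two inverse powers *)

Section PartialFractions.
Variable R : comUnitRingType.

(** The part of the expansion at one pole, up to a sign and the factor [x * z]; terms with [j < b]
    vanish. *)
Definition binom_sum (x z : R) (m b : nat) : R :=
  \sum_(j < m.+1) 'C(j, b)%:R * (x ^+ (m - j) * z ^+ j).

Lemma binom_sum_gt x z m b : (m < b)%N -> binom_sum x z m b = 0.
Proof.
move=> lt_mb; apply: big1 => j _; rewrite bin_small ?mul0r //.
exact: leq_ltn_trans (leq_ord j) lt_mb.
Qed.

Lemma binom_sumS0 x z m :
  binom_sum x z m.+1 0 = x ^+ m.+1 + z * binom_sum x z m 0.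
Proof.
rewrite /binom_sum big_ord_recl bin0 subn0 expr0 mulr1 mul1r.
congr (_ + _); rewrite mulr_sumr; apply: eq_bigr => j _.
by rewrite lift0 !bin0 subSS exprS; ring.
Qed.

Lemma binom_sumSS x z m b :
  binom_sum x z m.+1 b.+1 = z * (binom_sum x z m b.+1 + binom_sum x z m b).
Proof.
rewrite /binom_sum big_ord_recl bin0n mul0r add0r -big_split mulr_sumr.
apply: eq_bigr => j _.
by rewrite lift0 binS natrD subSS exprS /=; ring.
Qed.

(* Stated in terms of inverses x = 1/A, y = 1/B, z = 1/(A - B). *)
Lemma partial_fractions_inv (x y z : R) (a b : nat) :
  x * y = z * (y - x) ->
  x ^+ a.+1 * y ^+ b.+1 =
    (-1) ^+ b.+1 * (x * z) * binom_sum x z (a + b) b +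
    (-1) ^+ a.+1 * (y * - z) * binom_sum y (- z) (a + b) a.
Proof.
move=> xy; move: {2}(a + b)%N (erefl (a + b)%N) => m; elim: m a b => [|m IH].
  case=> [|//] [|//] _; rewrite /binom_sum big_ord1 !bin0 !expr0 !expr1 xy.
  by rewrite big_ord1 !bin0 !expr0; ring.
(* Replacing one factor [x * y] by [z * (y - x)] lowers the total exponent of [x] and [y] by one;
   hence the induction on [a + b]. *)
have step a b : x ^+ a.+1 * y ^+ b.+1 =
    z * (x ^+ a * y ^+ b.+1) - z * (x ^+ a.+1 * y ^+ b).
  have -> : x ^+ a.+1 * y ^+ b.+1 = x * y * (x ^+ a * y ^+ b).
    by rewrite !exprS; ring.
  by rewrite xy !exprS; ring.
case=> [|a] [|b] //.
(* At a zero index [step] leaves a pure power, matched by the leading term in [binom_sumS0]. *)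
- rewrite !add0n => -[eb]; rewrite step (IH 0 b) ?add0n //.
  rewrite binom_sumSS binom_sumS0 (@binom_sum_gt _ _ b b.+1) //.
  by rewrite !exprS; ring.
- rewrite !addn0 => -[ea]; rewrite step (IH a 0) ?addn0 //.
  rewrite binom_sumSS binom_sumS0 (@binom_sum_gt _ _ a a.+1) //.
  by rewrite !exprS; ring.
rewrite addSn addnS => -[e]; rewrite step (IH a b.+1) ?addnS // !binom_sumSS.
rewrite (IH a.+1 b) ?addSn ?addnS ?binom_sumSS //.
by rewrite !(exprS (-1)); ring.
Qed.

Lemma partial_fractions (A B : R) (a b : nat) :
  A \is a GRing.unit -> B \is a GRing.unit -> A - B \is a GRing.unit ->
  A ^- a.+1 * B ^- b.+1 =
    \sum_(j < (a + b).+1)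
      ((-1) ^+ b.+1 * 'C(j, b)%:R *
         (A ^- (a + b - j).+1 * (A - B) ^- j.+1) +
       (-1) ^+ a.+1 * 'C(j, a)%:R *
         (B ^- (a + b - j).+1 * (B - A) ^- j.+1)).
Proof.
move=> uA uB uAB; rewrite -!exprVn.
rewrite (@partial_fractions_inv _ _ (A - B)^-1); last first.
  apply: (mulrI uAB); rewrite mulVKr //.
  by rewrite mulrBl mulVKr // [A^-1 * _]mulrC mulVKr.
rewrite big_split /= /binom_sum !mulr_sumr.
have NAB : - (A - B)^-1 = (B - A)^-1 by rewrite -invrN opprB.
by congr (_ + _); apply: eq_bigr => j _;
  rewrite ?NAB -!exprVn !(exprS _^-1); ring.
Qed.

End PartialFractions.

(** * Power sums over a finite field, and sums over pairs sorted by rank *)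

Lemma sum_unit_expr (F : finFieldType) (j : nat) :
  \sum_(e : F | e != 0) e ^+ j = if (#|F|.-1 %| j)%N then -1 else 0.
Proof.
have gt1F := finNzRing_gt1 F.
have q0 : (0 < #|F|.-1)%N by rewrite -subn1 subn_gt0.
have exq (x : F) : x != 0 -> x ^+ #|F|.-1 = 1.
  move=> nx; apply: (mulfI nx).
  by rewrite mulr1 -exprS prednK ?expf_card // ltnW.
case: ifPn => [/dvdnP[k ->]|ndvd].
  rewrite (eq_bigr (fun=> 1)); last first.
    by move=> x nx; rewrite mulnC exprM exq // expr1n.
  (* Translation by 1 permutes [F], so [#|F|] copies of 1 add up to 0. *)
  have qE : (#|F|%:R : F) = 0.
    apply: (addIr (\sum_(x : F) x)); rewrite add0r.
    by rewrite [RHS](reindex_inj (addrI 1)) /= big_split sumr_const.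
  have -> : \sum_(i : F | i != 0) (1 : F) = #|F|.-1%:R.
    by rewrite sumr_const; congr (_ *+ _); apply: cardC1.
  by apply/eqP; rewrite -addr_eq0 -mulrSr prednK ?qE // ltnW.
(* Otherwise all [#|F|.-1] nonzero elements would be [k]-th roots of unity with
   [0 < k < #|F|.-1]. *)
have [g ng gj] : exists2 g : F, g != 0 & g ^+ j != 1.
  apply/exists_inP; rewrite -negb_forall_in; apply: contra ndvd.
  move=> /forall_inP all1; set k := (j %% #|F|.-1)%N.
  rewrite /dvdn -/k -leqn0 leqNgt; apply/negP => k_gt0.
  suff: (#|F|.-1 <= k)%N by rewrite leqNgt ltn_pmod.
  rewrite -(cardC1 (0 : F)) cardE.
  apply: max_unity_roots (enum_uniq _) => //.
  apply/allP => x; rewrite mem_enum => nx.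
  apply/unity_rootP; rewrite -(eqP (all1 x nx)) (divn_eq j #|F|.-1).
  by rewrite exprD mulnC exprM exq // expr1n mul1r.
(* Multiplication by [g] permutes the nonzero elements, so the sum is fixed by the factor
   [g ^+ j != 1] and vanishes. *)
have /eqP : \sum_(e : F | e != 0) e ^+ j =
    g ^+ j * \sum_(e : F | e != 0) e ^+ j.
  rewrite {1}(reindex_onto ( *%R g) ( *%R g^-1)) /=; last first.
    by move=> i _; rewrite mulVKf.
  rewrite mulr_sumr; apply: eq_big => [x|x _]; last by rewrite exprMn.
  by rewrite mulKf // eqxx andbT mulf_eq0 negb_or ng.
rewrite -subr_eq0 -{1}[X in X - _]mul1r -mulrBl mulf_eq0 subr_eq0 eq_sym.
by rewrite (negPf gj) => /eqP.
Qed.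

(** To be used with [h] the degree. In the two unequal cases the element of larger rank is outermost
    and bounds the inner sum, as in the recursion for [Hlt]. *)
Lemma sum_pairs_by_rank (V : nmodType) (I : finType) (P : pred I)
    (h : I -> nat) (f : I -> I -> V) (d : nat) :
  \sum_(x | P x && (h x < d)%N) \sum_(y | P y && (h y < d)%N) f x y =
    \sum_(x | P x && (h x < d)%N) \sum_(y | P y && (h y < h x)%N) f x y +
    \sum_(y | P y && (h y < d)%N) \sum_(x | P x && (h x < h y)%N) f x y +
    \sum_(x | P x && (h x < d)%N) f x x +
    \sum_(x | P x && (h x < d)%N)
      \sum_(y | [&& P y, h y == h x & y != x]) f x y.
Proof.
rewrite [X in _ + X + _ + _](exchange_big_dep (fun x => P x && (h x < d)%N)) /=;
  last first.
  by move=> y x /andP[_ hy] /andP[-> hx]; exact: ltn_trans hy.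
rewrite -!big_split; apply: eq_bigr => x /andP[Px hx] /=.
rewrite (bigID (fun y => h y < h x)%N) /= -!addrA; congr (_ + _);
  last rewrite (bigID (fun y => h x < h y)%N) /=; last congr (_ + _).
- apply: eq_bigl => y; rewrite -andbA; congr (_ && _).
  by case: (ltnP (h y) (h x)) => [h1|_]; rewrite ?andbF // (ltn_trans h1 hx).
- apply: eq_bigl => y; rewrite Px /= -!andbA; congr (_ && _).
  by case: (ltngtP (h y) (h x)); rewrite ?andbF ?andbT.
rewrite (bigD1 x) /= ?Px ?hx ?ltnn //; congr (_ + _).
apply: eq_bigl => y; case: (P y) => //=.
by case: (ltngtP (h y) (h x)) => [||->]; rewrite ?andbF ?hx.
Qed.

(** * Recursion for the sums [Hlt] *)

Section Sums.
Variables (F : finFieldType) (K : idomainType) (d0 : nat).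
Variable br : {poly_d0 F} -> K.

Notation mon a := (((a : {poly_d0 F}) : {poly F}) \is monic).
Notation deg a := (size ((a : {poly_d0 F}) : {poly F})).-1.

Lemma Hlt_nil d : Hlt br d [::] = 1.
Proof.
rewrite /Hlt (big_pred1 [tuple]) ?big_ord0 // => a.
by rewrite !tuple0 /= eqxx.
Qed.

(** The [path] condition on the tail starts at the degree of the head, so [deg x] replaces [d] as
    the bound. *)
Lemma Hlt_cons d k s :
  Hlt br d (k :: s) =
    \sum_(x | mon x && (deg x < d)%N) br x ^- val k * Hlt br (deg x) s.
Proof.
rewrite /Hlt [RHS](eq_bigr _ (fun x _ => mulr_sumr _ _ _ _)) pair_big_dep /=.
rewrite (reindex (fun q : _ * (size s).-tuple _ => [tuple of q.1 :: q.2])) /=;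
  last first.
  exists (fun t => (thead t, [tuple of behead t])) => [[x t] _|t _] /=.
    by congr (_, _); apply: val_inj.
  by rewrite [RHS]tuple_eta.
apply: eq_big => [[x t]|[x t] _] /=; first by rewrite andbACA.
rewrite big_ord_recl tnth0 (tnth_nth k) /=; congr (_ * _).
by apply: eq_bigr => i _; rewrite tnthS !(tnth_nth k).
Qed.

Lemma Hlt_xlet d k :
  Hlt br d [:: k] = \sum_(x | mon x && (deg x < d)%N) br x ^- val k.
Proof. by rewrite Hlt_cons; apply: eq_bigr => x _; rewrite Hlt_nil mulr1. Qed.

(** * The linear map [Hhat] in characteristic [p] *)

Section Linear.
Variable p : nat.
Hypothesis pcharK : p \in [pchar K].

(** Reduction modulo [p] is invisible in [K]; with the next three lemmas this makes the coefficient
    map of [Hhat] a ring morphism. *)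
Lemma Fp_natrD (a b : 'F_p) : (a + b)%R%:R = (a : nat)%:R + (b : nat)%:R :> K.
Proof.
rewrite /= [X in (_ %% X)%N]Fp_cast ?(pcharf_prime pcharK) //
  (GRing.natr_mod_pchar pcharK).
by rewrite natrD.
Qed.

Lemma Fp_natrM (a b : 'F_p) : (a * b)%R%:R = (a : nat)%:R * (b : nat)%:R :> K.
Proof.
rewrite /= [X in (_ %% X)%N]Fp_cast ?(pcharf_prime pcharK) //
  (GRing.natr_mod_pchar pcharK).
by rewrite natrM.
Qed.

Lemma Fp_natr1 : (1%R : 'F_p)%:R = 1 :> K.
Proof.
by rewrite /= [X in (_ %% X)%N]Fp_cast ?(pcharf_prime pcharK) //
  (GRing.natr_mod_pchar pcharK).
Qed.

Lemma Fp_natrN (a : 'F_p) : (- a)%R%:R = - (a : nat)%:R :> K.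
Proof. by apply/eqP; rewrite -addr_eq0 -Fp_natrD addNr. Qed.

Lemma HhatEw (D : {fset {fmonom posnat}}) d (u : rshuffle p) :
  (msupp u `<=` D)%fset ->
  Hhat br d u = \sum_(w <- D) (u@_w : nat)%:R * Hlt br d w.
Proof.
move=> leD; rewrite /Hhat mmapE (big_fset_incl _ leD) // => w _.
by move/mcoeff_outdom->; rewrite mul0r.
Qed.

Lemma Hhat_linear d (c : 'F_p) (u v : rshuffle p) :
  Hhat br d (c *: u + v) = (c : nat)%:R * Hhat br d u + Hhat br d v.
Proof.
set D := (msupp u `|` msupp v)%fset.
have leD : (msupp (c *: u + v) `<=` D)%fset.
  exact: fsubset_trans (msuppD_le _ _) (fsetSU _ (msuppZ_le c u)).
rewrite (HhatEw d leD) (HhatEw d (fsubsetUl _ (msupp v))).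
rewrite (HhatEw d (fsubsetUr (msupp u) _)) mulr_sumr -big_split.
apply: eq_bigr => w _ /=.
by rewrite mcoeffD mcoeffZ Fp_natrD Fp_natrM mulrDl mulrA.
Qed.

Lemma Hhat0 d : Hhat br d (0 : rshuffle p) = 0.
Proof. by rewrite /Hhat mmapE msupp0 big_seq_fset0. Qed.

Lemma HhatD d : {morph Hhat br d : u v / (u : rshuffle p) + v >-> u + v}.
Proof. by move=> u v; rewrite -{1}[u]scale1r Hhat_linear Fp_natr1 mul1r. Qed.

Lemma HhatZ d (c : 'F_p) (u : rshuffle p) :
  Hhat br d (c *: u) = (c : nat)%:R * Hhat br d u.
Proof. by rewrite -[c *: u]addr0 Hhat_linear Hhat0 addr0. Qed.

Lemma Hhat_sum d I (l : seq I) (P : pred I) (f : I -> rshuffle p) :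
  Hhat br d (\sum_(i <- l | P i) f i) = \sum_(i <- l | P i) Hhat br d (f i).
Proof. exact: (big_morph _ (HhatD d) (Hhat0 d)). Qed.

Lemma Hhat_xword d s : Hhat br d (xword p s) = Hlt br d s.
Proof.
rewrite (HhatEw d msuppU_le) big_seq_fset1 mcoeffUU Fp_natr1.
exact: mul1r.
Qed.

(** The linear extension of [Hlt_cons]: prefixing a letter becomes a sum over the leading
    polynomial. *)
Lemma Hhat_xlet_mul d k (u : rshuffle p) :
  Hhat br d (xlet p k * u) =
    \sum_(x | mon x && (deg x < d)%N) br x ^- val k * Hhat br (deg x) u.
Proof.
rewrite malgM_def fgmulUg Hhat_sum.
under [RHS]eq_bigr => x _ do rewrite /Hhat mmapE mulr_sumr.
rewrite exchange_big; apply: eq_bigr => w _ /=.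
rewrite mul1r (HhatEw d msuppU_le) big_seq_fset1 mcoeffUU fmM.
by rewrite Hlt_cons mulr_sumr; apply: eq_bigr => x _; rewrite mulrCA.
Qed.

(** By bilinearity. Only words in the supports are tested, since the induction controls only words
    of bounded depth. *)
Lemma Hhat_star d r (u v : rshuffle p) :
  (forall s t, s \in msupp u -> t \in msupp v ->
    Hhat br d (star r (xword p s) (xword p t)) = Hlt br d s * Hlt br d t) ->
  Hhat br d (star r u v) = Hhat br d u * Hhat br d v.
Proof.
move=> mulH; rewrite /star Hhat_sum [in RHS]/Hhat !mmapE mulr_suml.
apply: eq_big_seq => s su.
rewrite Hhat_sum mulr_sumr; apply: eq_big_seq => t tv.
by rewrite HhatZ -star_xword mulH // Fp_natrM mulrACA.
Qed.

End Linear.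

(** * Sums over differences of monic polynomials *)

Section Bracket.
Variable iota : {rmorphism F -> K}.
Hypothesis br_unit : forall a : {poly_d0 F}, mon a -> br a \is a GRing.unit.
Hypothesis brD : forall a b : {poly_d0 F}, br (a + b) = br a + br b.
Hypothesis brZ : forall (c : F) (a : {poly_d0 F}), br (c *: a) = iota c * br a.

Lemma brB a b : br (a - b) = br a - br b.
Proof. by rewrite -scaleN1r brD brZ rmorphN1 mulN1r. Qed.

Lemma mon_neq0 (a : {poly_d0 F}) : mon a -> a != 0.
Proof. by move/monic_neq0; apply: contraNN => /eqP->. Qed.

Lemma monic_npoly (a : {poly_d0 F}) : a != 0 ->
  mon ((lead_coef (a : {poly F}))^-1 *: a).
Proof.
by move=> na; rewrite monicE linearZ lead_coefZ mulVf // lead_coef_eq0.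
Qed.

(** Factor out the leading coefficient. This makes the differences in the partial fractions
    invertible. *)
Lemma brN0_unit (a : {poly_d0 F}) : a != 0 -> br a \is a GRing.unit.
Proof.
move=> na; have lc : lead_coef (a : {poly F}) != 0 by rewrite lead_coef_eq0.
rewrite -[a](scalerKV lc) brZ unitrM br_unit ?monic_npoly // andbT.
by rewrite rmorph_unit // unitfE.
Qed.

Lemma size_monic_le (a : {poly_d0 F}) e : mon a ->
  (size (a : {poly F}) <= e)%N = (deg a < e)%N.
Proof. by move=> /monic_neq0; rewrite -size_poly_gt0; case: size. Qed.

(** Each nonzero [c] is a scalar times a unique monic [n]; the scalars contribute a power sum over
    the nonzero elements of [F], which is -1 or 0. *)
Lemma sum_br_expV (j e : nat) :
  \sum_(c : {poly_d0 F} | (c != 0) && (size (c : {poly F}) <= e)%N)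
     br c ^- j.+1 =
    if (#|F|.-1 %| j.+1)%N then - Hlt br e [:: posS j] else 0.
Proof.
pose lc (c : {poly_d0 F}) := lead_coef (c : {poly F}).
have lcZ c n : mon n -> lc (c *: n) = c.
  by move=> /monicP n1; rewrite /lc linearZ lead_coefZ n1 mulr1.
rewrite (partition_big (fun c => (lc c)^-1 *: c)
  (fun n => mon n && (deg n < e)%N)) /=; last first.
  move=> c /andP[nc sc]; have mc := monic_npoly nc.
  rewrite mc -(size_monic_le _ mc) (leq_trans _ sc) //.
  exact: size_scale_leq.
transitivity (\sum_(n | mon n && (deg n < e)%N)
    iota (\sum_(c : F | c != 0) c ^- j.+1) * br n ^- j.+1).
  apply: eq_bigr => n /andP[mn sn].
  rewrite (reindex_onto (fun c => c *: n) lc) /=; last first.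
    move=> c /andP[/andP[nc _] /eqP <-]; rewrite scalerKV //.
    by rewrite lead_coef_eq0.
  rewrite rmorph_sum mulr_suml.
  apply: eq_big => [c|c /andP[/andP[/andP[ncn _] _] _]]; last first.
    have nc : c != 0 by apply: contraNneq ncn => ->; rewrite scale0r.
    rewrite brZ exprMn invrM ?unitrX ?br_unit ?rmorph_unit ?unitfE //.
    by rewrite mulrC fmorphV rmorphXn.
  rewrite lcZ // eqxx andbT.
  have [->|nc] := eqVneq c 0; first by rewrite scale0r eqxx.
  rewrite scalerK // eqxx andbT scaler_eq0 (negPf nc) (negPf (mon_neq0 mn)) /=.
  by rewrite size_scale // size_monic_le.
(* Inversion permutes the nonzero scalars. *)
have -> : \sum_(c : F | c != 0) c ^- j.+1 = \sum_(c : F | c != 0) c ^+ j.+1.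
  rewrite (reindex_inj invr_inj); apply: eq_big => [c|c _] /=.
    by rewrite invr_eq0.
  by rewrite exprVn invrK.
rewrite sum_unit_expr; case: ifP => _; last first.
  by rewrite rmorph0; apply: big1 => n _; rewrite mul0r.
rewrite Hlt_xlet -sumrN; apply: eq_bigr => n _.
by rewrite rmorphN1 mulN1r.
Qed.

(** The leading terms of two monic polynomials of equal degree cancel; so the [y] paired with [x]
    are parametrised by the nonzero [c = x - y] of lower degree. *)
Lemma monicB_deg (x c : {poly_d0 F}) : mon x ->
  [&& mon (x - c), deg (x - c) == deg x & x - c != x] =
    (c != 0) && (size (c : {poly F}) <= deg x)%N.
Proof.
move=> mx; rewrite andbA [RHS]andbC.
have -> : (x - c != x) = (c != 0).
  by rewrite -subr_eq0 addrAC subrr sub0r oppr_eq0.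
congr (_ && _); rewrite linearB /=.
have sx : size (x : {poly F}) = (deg x).+1.
  by rewrite prednK // size_poly_gt0 monic_neq0.
apply/andP/idP => [[my /eqP e]|sc].
  have sy : size ((x : {poly F}) - c) = (deg x).+1.
    by rewrite -e prednK // size_poly_gt0 monic_neq0.
  apply/leq_sizeP => i; rewrite leq_eqVlt => /predU1P[<-|lti].
    have := monicP my; rewrite /lead_coef e coefB -/(lead_coef _) (monicP mx).
    by move/eqP; rewrite -subr_eq0 addrAC subrr sub0r oppr_eq0 => /eqP.
  have /(nth_default 0) : (size ((x : {poly F}) - c)%R <= i)%N by rewrite sy.
  by rewrite coefB nth_default 1?sx // sub0r => /eqP; rewrite oppr_eq0 => /eqP.
have lt_cx : (size (- (c : {poly F}))%R < size (x : {poly F}))%N.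
  by rewrite size_polyN sx.
by rewrite monicE lead_coefDl // size_polyDl // (monicP mx) !eqxx.
Qed.

(** Substitute [y = x - c], so that [br x - br y] becomes [br c]. *)
Lemma sum_diff_expV (x : {poly_d0 F}) (j : nat) : mon x ->
  \sum_(y | [&& mon y, deg y == deg x & y != x]) (br x - br y) ^- j.+1 =
    if (#|F|.-1 %| j.+1)%N then - Hlt br (deg x) [:: posS j] else 0.
Proof.
move=> mx; rewrite -sum_br_expV.
rewrite (reindex_onto (fun c => x - c) (fun c => x - c)); last first.
  by move=> c _; rewrite opprB addrC subrK.
apply: eq_big => [c|c _]; last by rewrite -brB opprB addrC subrK.
by rewrite monicB_deg // opprB addrC subrK eqxx andbT.
Qed.

(** Partial fractions give two families of terms exchanged by swapping [x] and [y]. The weight [G]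
    depends only on the common degree, so both families have the same sum [S j f] and their
    coefficients add. *)
Lemma sum_same_degree (d a b : nat) (G : nat -> K) :
  \sum_(x | mon x && (deg x < d)%N)
    \sum_(y | [&& mon y, deg y == deg x & y != x])
      br x ^- a.+1 * br y ^- b.+1 * G (deg x) =
  \sum_(j < (a + b).+1)
    (if (#|F|.-1 %| j.+1)%N
     then (-1) ^+ a * 'C(j, a)%:R + (-1) ^+ b * 'C(j, b)%:R else 0) *
    \sum_(x | mon x && (deg x < d)%N)
      br x ^- (a + b - j).+1 * (G (deg x) * Hlt br (deg x) [:: posS j]).
Proof.
pose S (j : nat) (f : nat -> {poly_d0 F} -> {poly_d0 F} -> K) :=
  \sum_(x | mon x && (deg x < d)%N)
  \sum_(y | [&& mon y, deg y == deg x & y != x]) f j x y * G (deg x).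
pose f j x y := br x ^- (a + b - j).+1 * (br x - br y) ^- j.+1.
have S_sym j : S j (fun j x y => f j y x) = S j f.
  rewrite /S [LHS](exchange_big_dep (fun y => mon y && (deg y < d)%N)) /=;
    last first.
    by move=> x y /andP[_ hx] /and3P[-> /eqP-> _].
  apply: eq_bigr => x /andP[mx hx]; apply: eq_big => [y|y]; last first.
    by case/andP => _ /and3P[_ /eqP-> _].
  rewrite mx eq_sym [x == y]eq_sym /=; case: eqP => [->|_]; rewrite ?andbF //.
  by rewrite hx andbT.
transitivity (\sum_(j < (a + b).+1)
    ((-1) ^+ b.+1 * 'C(j, b)%:R + (-1) ^+ a.+1 * 'C(j, a)%:R) * S j f).
  transitivity (\sum_(j < (a + b).+1) ((-1) ^+ b.+1 * 'C(j, b)%:R * S j f +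
      (-1) ^+ a.+1 * 'C(j, a)%:R * S j (fun j x y => f j y x))); last first.
    by apply: eq_bigr => j _; rewrite S_sym mulrDl.
  rewrite /S; under [RHS]eq_bigr => j _ do
    rewrite !mulr_sumr -big_split /=.
  rewrite exchange_big; apply: eq_bigr => x /andP[mx _] /=.
  under [RHS]eq_bigr => j _ do rewrite !mulr_sumr -big_split /=.
  rewrite exchange_big; apply: eq_bigr => y /and3P[my _ nyx] /=.
  rewrite partial_fractions ?br_unit //; last first.
    by rewrite -brB brN0_unit // subr_eq0 eq_sym.
  by rewrite mulr_suml; apply: eq_bigr => j _; rewrite mulrDl !mulrA.
apply: eq_bigr => j _; have -> : S j f =
    if (#|F|.-1 %| j.+1)%N then - \sum_(x | mon x && (deg x < d)%N)
      br x ^- (a + b - j).+1 * (G (deg x) * Hlt br (deg x) [:: posS j]) else 0.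
  transitivity (\sum_(x | mon x && (deg x < d)%N)
      br x ^- (a + b - j).+1 * (G (deg x) *
        if (#|F|.-1 %| j.+1)%N then - Hlt br (deg x) [:: posS j] else 0)).
    apply: eq_bigr => x /andP[mx _]; rewrite -sum_diff_expV // !mulr_sumr.
    by apply: eq_bigr => y _; rewrite /f mulrAC mulrA.
  case: ifP => _; last by apply: big1 => x _; rewrite !mulr0.
  by rewrite -sumrN; apply: eq_bigr => x _; rewrite !mulrN.
case: ifP => _; last by rewrite mulr0 mul0r.
(* The sign from the power sum turns [(-1) ^+ a.+1] into [(-1) ^+ a], and likewise for [b]. *)
by rewrite mulrN -mulNr !exprS; ring.
Qed.

End Bracket.
End Sums.

(** * The shuffle recursion and the induction on depth *)

Lemma sum_ord_antidiag (V : nmodType) (m : nat) (f : nat -> nat -> V) :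
  \sum_(i < m.+2) \sum_(j < m.+2 | (i.+1 + j.+1 == m.+2)%N) f i j =
    \sum_(j < m.+1) f (m - j)%N j.
Proof.
(* For [j <= m] the only solution is [i = m - j]; the last value [j = m.+1] admits none. *)
rewrite (exchange_big_dep xpredT) //= big_ord_recr /= [X in _ + X]big_pred0.
  rewrite addr0; apply: eq_bigr => j _; have lejm := leq_ord j.
  rewrite (big_pred1 (inord (m - j))) => [|i /=].
    by rewrite inordK // ltnS (leq_trans (leq_subr _ _)).
  rewrite -val_eqE /= inordK; last by rewrite ltnS (leq_trans (leq_subr _ _)).
  by rewrite addSn addnS !eqSS -[in RHS](eqn_add2r j) subnK.
by move=> i; rewrite -[X in _ == X]add0n eqn_add2r.
Qed.

Lemma posS_pred (a : posnat) : a = posS (val a).-1.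
Proof. by apply: val_inj; rewrite /= prednK // (valP a). Qed.

(** Shifted exponents absorb the predecessors in [Delta], so that its image in [K] is the
    coefficient in [sum_same_degree]. *)
Lemma Delta_natr (K : idomainType) p r a b i j : p \in [pchar K] ->
  (Delta p r a.+1 b.+1 i j.+1 : nat)%:R =
    (if (r.-1 %| j.+1)%N
     then (-1) ^+ a * 'C(j, a)%:R + (-1) ^+ b * 'C(j, b)%:R else 0) :> K.
Proof.
move=> ch; have p_pr := pcharf_prime ch.
have sgn n : (((-1) ^+ n)%R : 'F_p)%:R = (-1) ^+ n :> K.
  elim: n => [|n IH]; first by rewrite !expr0 Fp_natr1.
  by rewrite !exprS Fp_natrM // Fp_natrN // Fp_natr1 // IH.
have nat_r n : (n%:R%R : 'F_p)%:R = n%:R :> K.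
  by rewrite val_Fp_nat // (GRing.natr_mod_pchar ch).
rewrite /Delta; case: ifP => // _.
by rewrite Fp_natrD // !Fp_natrM // !sgn !nat_r.
Qed.

Lemma size_msupp_star p r s t (w : {fmonom posnat}) :
  w \in msupp (star r (xword p s) (xword p t)) -> (size w <= size s + size t)%N.
Proof.
rewrite star_xword -mcoeff_neq0 leqNgt.
by apply: contraNN => /depth_le_shuf ->.
Qed.

(* The defining recursion of the r-shuffle product, with the recursive calls
   replaced by arbitrary u1, u2, u3 and u4 having the expected images. *)
Lemma Hhat_shuffle_step (p : nat) (F : finFieldType) (K : idomainType)
    (iota : {rmorphism F -> K}) (d0 : nat) (br : {poly_d0 F} -> K)
    (a b : posnat) (s t : pindex) (u1 u2 u3 : rshuffle p)
    (u4 : posnat -> rshuffle p) (d : nat) :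
  p \in [pchar K] ->
  (forall a : {poly_d0 F}, (a : {poly F}) \is monic -> br a \is a GRing.unit) ->
  (forall a b : {poly_d0 F}, br (a + b) = br a + br b) ->
  (forall (c : F) (a : {poly_d0 F}), br (c *: a) = iota c * br a) ->
  (forall e, Hhat br e u1 = Hlt br e s * Hlt br e (b :: t)) ->
  (forall e, Hhat br e u2 = Hlt br e (a :: s) * Hlt br e t) ->
  (forall e, Hhat br e u3 = Hlt br e s * Hlt br e t) ->
  (forall e j, Hhat br e (u4 j) = Hlt br e s * Hlt br e t * Hlt br e [:: j]) ->
  Hhat br d (xlet p a * u1 + xlet p b * u2 + xlet p (posD a b) * u3
    + \sum_(i < val a + val b)
        \sum_(j < val a + val b | (i.+1 + j.+1 == val a + val b)%N)
          Delta p #|F| (val a) (val b) i.+1 j.+1 *: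
            (xlet p (posS i) * u4 (posS j))) =
    Hlt br d (a :: s) * Hlt br d (b :: t).
Proof.
move=> ch br_unit brD brZ H1 H2 H3 H4.
have HD4 (v1 v2 v3 v4 : rshuffle p) : Hhat br d (v1 + v2 + v3 + v4) =
    Hhat br d v1 + Hhat br d v2 + Hhat br d v3 + Hhat br d v4.
  by rewrite !(HhatD br ch d).
rewrite HD4 !Hlt_cons big_distrlr /= sum_pairs_by_rank.
(* The four classes of pairs of leading polynomials match the four summands of the recursion, in
   order. *)
congr (_ + _ + _ + _).
- rewrite (Hhat_xlet_mul br ch).
  apply: eq_bigr => x _; rewrite H1 Hlt_cons mulrA mulr_sumr.
  exact: eq_bigr.
- rewrite (Hhat_xlet_mul br ch).
  apply: eq_bigr => y _; rewrite H2 Hlt_cons mulrCA mulr_suml.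
  exact: eq_bigr.
- rewrite (Hhat_xlet_mul br ch).
  apply: eq_bigr => x /andP[mx _]; rewrite H3 exprD invrM ?unitrX ?br_unit //.
  by rewrite [X in X * _ = _]mulrC mulrACA.
rewrite {H1 H2 H3} (posS_pred a) (posS_pred b).
move: (val a).-1 (val b).-1 => {}a {}b.
pose G e := Hlt br e s * Hlt br e t.
transitivity (\sum_(j < (a + b).+1)
    (Delta p #|F| a.+1 b.+1 (a + b - j).+1 j.+1 : nat)%:R *
    \sum_(x : {poly_d0 F} |
        ((x : {poly F}) \is monic) && ((size (x : {poly F})).-1 < d)%N)
      br x ^- (a + b - j).+1 *
        (G (size (x : {poly F})).-1 *
           Hlt br (size (x : {poly F})).-1 [:: posS j])).
  rewrite /= addSn addnS (sum_ord_antidiag (a + b) (fun i j =>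
    Delta p #|F| a.+1 b.+1 i.+1 j.+1 *: (xlet p (posS i) * u4 (posS j)))).
  rewrite (Hhat_sum br ch); apply: eq_bigr => j _.
  rewrite (HhatZ br ch) (Hhat_xlet_mul br ch); congr (_ * _).
  by apply: eq_bigr => x _; rewrite H4.
under eq_bigr => j _ do rewrite (Delta_natr _ _ _ _ _ ch).
rewrite -(sum_same_degree br_unit brD brZ).
apply: eq_bigr => x _; apply: eq_bigr => y /and3P[_ /eqP dy _].
by rewrite dy mulrACA.
Qed.

(** Induction on total depth, for all bounds [d] at once because the tails are evaluated at the
    degree of the leading polynomial. *)
Lemma Hhat_star_xword (p : nat) (F : finFieldType) (K : idomainType)
    (iota : {rmorphism F -> K}) (d0 : nat) (br : {poly_d0 F} -> K) :
  p \in [pchar K] ->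
  (forall a : {poly_d0 F}, (a : {poly F}) \is monic -> br a \is a GRing.unit) ->
  (forall a b : {poly_d0 F}, br (a + b) = br a + br b) ->
  (forall (c : F) (a : {poly_d0 F}), br (c *: a) = iota c * br a) ->
  forall (s t : pindex) (d : nat),
    Hhat br d (star #|F| (xword p s) (xword p t)) = Hlt br d s * Hlt br d t.
Proof.
move=> ch br_unit brD brZ s t.
move: {2}(size s + size t)%N (leqnn (size s + size t)) => n.
elim: n s t => [|n IH] [|a s].
- by move=> t _ d; rewrite star1x !(Hhat_xword _ ch) Hlt_nil mul1r.
- by move=> t; rewrite addSn.
- by move=> t _ d; rewrite star1x !(Hhat_xword _ ch) Hlt_nil mul1r.
case=> [_ d|b t]; first by rewrite starx1 !(Hhat_xword _ ch) Hlt_nil mulr1.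
rewrite [size (a :: s)]/= [size (b :: t)]/= addSn addnS ltnS => le_n d.
rewrite star_cons; apply: (Hhat_shuffle_step
  (u4 := fun j => star #|F| (star #|F| (xword p s) (xword p t)) (xlet p j))
  d ch br_unit brD brZ) => [e|e|e|e j].
- by apply: IH; rewrite /= addnS.
- by apply: IH; rewrite /= addSn.
- by apply: IH; apply: ltnW.
rewrite (Hhat_star ch).
  rewrite (Hhat_xword br ch e [:: j]); congr (_ * _).
  by apply: IH; apply: ltnW.
(* A word from the product of the tails, together with the letter [j], still has total depth at most
   [n]. *)
move=> u v /size_msupp_star su /(fsubsetP msuppU_le); rewrite in_fset1 => /eqP->.
by apply: IH; rewrite /= addn1 (leq_ltn_trans su).
Qed.

Theorem theorem3p10
  (p e r : nat) (p_prime : prime p) (e_gt0 : (0 < e)%N) (rE : r = (p ^ e)%N)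
  (F : finFieldType) (cardF : #|F| = r)
  (K : idomainType) (iota : {rmorphism F -> K})
  (d0 : nat) (d0_gt0 : (0 < d0)%N) (br : {poly_d0 F} -> K)
  (br_unit : forall a : {poly_d0 F},
     (a : {poly F}) \is monic -> br a \is a GRing.unit)
  (brD : forall a b : {poly_d0 F}, br (a + b) = br a + br b)
  (brZ : forall (eps : F) (a : {poly_d0 F}), br (eps *: a) = iota eps * br a)
  (d : nat) (d_bounds : (1 <= d <= d0)%N) :
  [/\ (forall (c : 'F_p) (u v : rshuffle p),
         Hhat br d (c *: u + v) = (c : nat)%:R * Hhat br d u + Hhat br d v),
      Hhat br d (xword p [::]) = 1,
      (forall u v : rshuffle p,
         Hhat br d (star r u v) = Hhat br d u * Hhat br d v)
    & (forall s t : pindex,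
         Hhat br d (star r (xword p s) (xword p t)) = Hlt br d s * Hlt br d t)].
Proof.
(* [F] has [p ^ e] elements, and [iota] carries its characteristic over to [K]. *)
have pcharK : p \in [pchar K].
  by rewrite (rmorph_pchar iota) // (card_finPcharP (n := e)) // cardF.
have starE := Hhat_star_xword pcharK br_unit brD brZ; rewrite cardF in starE.
split=> [c u v||u v|s t].
- exact: Hhat_linear.
- by rewrite (Hhat_xword _ pcharK) Hlt_nil.
- by apply: Hhat_star => // s t _ _; apply: starE.
- exact: starE.
Qed.
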